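(* Assume $\operatorname{char}\Bbbk\neq2$, $N\ge2$ and $1\le i\le N-1$. For each finitely supported sequence $\{\epsilon_\ell\}_{\ell\ge1}\in\Bbbk^{\mathbb Z_{\ge1}}=\bigoplus_{\ell\ge1}\Bbbk$, the formulas $$\eta^0(T_j)=\begin{cases}\sum_{\ell=1}^\infty\epsilon_\ell\,s_j^\ell,& j\ne i,\\[2pt] \sum_{\ell=1}^\infty\epsilon_\ell\,\big[\tfrac12 q_{i-1}s^{\ell-1},\ \tfrac12p_{i+1}s^{\ell-1}\big],& j=i,\end{cases}$$ $$\eta^1(a_{kj}s^\alpha)=\begin{cases}0,&k\ne i,\\ \operatorname{sgn}(i-j)\sum_{\ell=1}^\infty\tfrac12\epsilon_\ell\,a_{ij}s^{\alpha+\ell-1},&k=i,\end{cases}$$ and $\eta^2=\eta^3=\cdots=0$, define a degree $0$ $A_\infty$-natural transformation $\eta_{\{\epsilon_\ell\}}:\mathrm{id}\Rightarrow\beta_{i^-}$, and these represent all cohomology classes of degree $0$ natural transformations exactly once: $\{\epsilon_\ell\}\mapsto[\eta_{\{\epsilon_\ell\}}]$ is an isomorphism $\Bbbk^{\mathbb Z_{\ge1}}\cong\mathrm{HH}^0(\mathfrak B_{i^-})=H^0\operatorname{Hom}(\mathrm{id},\beta_{i^-})$. Here $[x,y]$ denotes the degree $0$ morphism $T_i\to\beta_{i^-}T_i$ with components $x:T_i\to T_{i-1}$ and $y:T_i\to T_{i+1}$, and the value of $\eta^1$ for $k=i$ is the degree $-1$ morphism $T_j\to\beta_{i^-}T_i$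 into the degree $-1$ term $T_i$.
   Context: Let $\Bbbk$ be a field. $\mathcal C$ is the $\Bbbk$-linear category (concentrated in degree $0$, only $\mu^2$ nonzero) with objects $T_0,\dots,T_N$, where $\operatorname{Hom}(T_i,T_j)$ has $\Bbbk$-basis $\{a_{ji}s^\alpha\}_{\alpha\ge0}$ and composition $a_{kj}s^\beta\cdot a_{ji}s^\alpha=a_{ki}s^{\alpha+\beta+\delta(i,j,k)}$, $\delta(i,j,k)=\frac12(|i-j|+|j-k|-|i-k|)$. Notation: $s_i^\alpha=a_{ii}s^\alpha$, $p_i=a_{i,i-1}$, $q_i=a_{i,i+1}$, $q_{i-1}s^\alpha=a_{i-1,i}s^\alpha$, $p_{i+1}s^\alpha=a_{i+1,i}s^\alpha$; $\operatorname{sgn}(0)=0$. $\mathrm{Tw}^b(\mathcal C)$ is the category of bounded complexes over $\mathcal C$: objects carry a differential $\delta$, morphisms are graded matrices of morphisms, $\mu^1_\delta(x)=(-1)^{|x|}\delta x-x\delta$, $\mu^2_\delta(x_2,x_1)=(-1)^{|x_1|}x_2x_1$ (naive products on the right), and $\mu_\delta^{d}=0$ for $d\geq3$. The negative braiding functor $\beta_{i^-}:\mathcal C\to\mathrm{Tw}^b(\mathcal C)$ (extended to $\mathrm{Tw}^b(\mathcal C)$) is the following $A_\infty$-functor. Objects: $\beta_{i^-}T_j=T_j$ for $j\ne i$; $\beta_{i^-}T_i=\big(T_i\xrightarrow{[q_{i-1},\,-p_{i+1}]}T_{i-1}\oplus T_{i+1}\big)$ with $T_i$ in degree $-1$ and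 $T_{i-1}\oplus T_{i+1}$ in degree $0$. First component $\beta_{i^-}^1$ (degree $0$): (a) $a_{kj}s^\alpha\mapsto a_{kj}s^\alpha$ if $j,k\ne i$; (b) $a_{ij}s^\alpha$ with $j>i$ (resp. $j<i$) maps to $a_{i+1,j}s^\alpha:T_j\to T_{i+1}$ (resp. $a_{i-1,j}s^\alpha:T_j\to T_{i-1}$); (c) $a_{ki}s^\alpha$ with $k>i$ maps to the morphism with components $a_{k,i-1}s^\alpha$ on $T_{i-1}$ and $a_{k,i+1}s^{\alpha+1}$ on $T_{i+1}$, and with $k<i$ to the morphism with components $a_{k,i-1}s^{\alpha+1}$ on $T_{i-1}$ and $a_{k,i+1}s^\alpha$ on $T_{i+1}$; (d) $s_i^\alpha$ maps to the diagonal morphism with entries $s_i^\alpha,s_{i-1}^\alpha,s_{i+1}^\alpha$. Second component $\beta_{i^-}^2(a_{lk}s^\beta,a_{kj}s^\alpha)$ (degree $-1$): it is $0$ if $l\neq i$; if $l=i\ne j$ it is $0$ when $(i-j)(i-k)\ge0$, and $\operatorname{sgn}(i-k)a_{ij}s^{\beta+\alpha+|i-k|-1}$ into the degree $-1$ term $T_i$ when $(i-j)(i-k)<0$; if $l=j=i$ it is $\operatorname{sgn}(i-k)\,a_{i,i+\operatorname{sgn}(i-k)}s^{\beta+\alpha+|i-k|-1}$ from the summand $T_{i+\operatorname{sgn}(i-k)}$ of the degree $0$ term to the degree $-1$ term $T_i$ (so $0$ if $k=i$). $\beta_{i^-}^d=0$ for $d\ge3$. The associated $(\mathcal C,\mathcal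 C)$-bimodule is denoted $\mathfrak B_{i^-}$. A degree $g$ pre-natural transformation $\eta:\mathrm{id}\Rightarrow\beta_{i^-}$ consists of multilinear maps $\eta^d:\operatorname{Hom}(X_{d-1},X_d)\otimes\cdots\otimes\operatorname{Hom}(X_0,X_1)\to\operatorname{Hom}^{g-d}(X_0,\beta_{i^-}X_d)$, $d\ge0$, on objects $X_m$ of $\mathcal C$. The differential is $$\begin{aligned}\mu^1(\eta)^d(a_d,\dots,a_1)=\;&\mu^1_\delta\big(\eta^d(a_d,\dots,a_1)\big)+\sum_{m=0}^{d-1}\mu^2_\delta\big(\beta_{i^-}^{d-m}(a_d,\dots,a_{m+1}),\eta^m(a_m,\dots,a_1)\big)\\&+(-1)^{g-1}\mu^2_\delta\big(\eta^{d-1}(a_d,\dots,a_2),a_1\big)-\sum_{n=0}^{d-2}(-1)^{n+g-1}\eta^{d-1}(a_d,\dots,a_{n+2}\cdot a_{n+1},\dots,a_1)\end{aligned}$$ (terms with $\eta^{d-1}$ absent for $d=0$). $\eta$ is an $A_\infty$-natural transformation if $\mu^1(\eta)=0$; $\mathrm{HH}^g(\mathfrak B_{i^-})=H^g\operatorname{Hom}(\mathrm{id},\beta_{i^-})$ is the degree-$g$ cohomology of this complex. *)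

(* Defs.v *)
From HB Require Import structures.
From mathcomp Require Import all_boot all_order all_algebra.
From mathcomp Require Import boolp.

Set Implicit Arguments.
Unset Strict Implicit.
Unset Printing Implicit Defensive.
Import Order.TTheory GRing.Theory Num.Theory.
Local Open Scope ring_scope.

Section LmodQuotient.
Variables (R : pzRingType) (V : lmodType R).
Variables (S : V -> bool) (S_submod : submod_closed (S : {pred V})).

Definition submod_pred & submod_closed (S : {pred V}) : {pred V} := S.
HB.instance Definition _ := GRing.isZmodClosed.Build V
  (submod_pred S_submod) (GRing.submod_closedB S_submod).
Local Notation B := (submod_pred S_submod).

Definition lmod_quot : Type := Quotient.quot B.
HB.instance Definition _ := GRing.Zmodule.on lmod_quot.

Definition lmod_pi (v : V) : lmod_quot := (\pi_(Quotient.quot B) v)%qT.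

Lemma lmod_piE (u v : V) : (lmod_pi u = lmod_pi v) <-> u - v \in (S : {pred V}).
Proof.
have -> : (u - v \in (S : {pred V})) = (u == v %[mod Quotient.quot B])%qT.
  exact: (Quotient.idealrBE B u v).
exact: rwP eqP.
Qed.

Lemma lmod_pi_surj (x : lmod_quot) : exists v, x = lmod_pi v.
Proof. by exists (repr x); rewrite /lmod_pi reprK. Qed.

Lemma lmod_piD : {morph lmod_pi : u v / u + v}.
Proof. by move=> u v; rewrite /lmod_pi piE. Qed.

Definition lmod_quot_scale (c : R) (x : lmod_quot) : lmod_quot :=
  lmod_pi (c *: (repr x : V)).

Lemma lmod_piZ c u : lmod_pi (c *: u) = lmod_quot_scale c (lmod_pi u).
Proof.
apply/lmod_piE; rewrite -scalerBr.
apply: (GRing.subsemimod_closedZ (GRing.submod_closed_semi S_submod)).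
by apply/lmod_piE; rewrite /lmod_pi reprK.
Qed.

Let scaleqA c d x :
  lmod_quot_scale c (lmod_quot_scale d x) = lmod_quot_scale (c * d) x.
Proof. by have [v ->] := lmod_pi_surj x; rewrite -!lmod_piZ scalerA. Qed.
Let scale1q : left_id 1 lmod_quot_scale.
Proof. by move=> x; have [v ->] := lmod_pi_surj x; rewrite -lmod_piZ scale1r. Qed.
Let scaleqDr : right_distributive lmod_quot_scale +%R.
Proof.
move=> c x y; have [u ->] := lmod_pi_surj x; have [v ->] := lmod_pi_surj y.
by rewrite -lmod_piD -!lmod_piZ -lmod_piD scalerDr.
Qed.
Let scaleqDl x : {morph lmod_quot_scale^~ x : c d / c + d}.
Proof.
move=> c d; have [u ->] := lmod_pi_surj x.
by rewrite -!lmod_piZ -lmod_piD scalerDl.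
Qed.
HB.instance Definition _ :=
  GRing.Zmodule_isLmodule.Build R lmod_quot scaleqA scale1q scaleqDr scaleqDl.

Lemma lmod_pi_linear : linear lmod_pi.
Proof. by move=> c u v; rewrite lmod_piD lmod_piZ. Qed.
HB.instance Definition _ :=
  GRing.isLinear.Build R V lmod_quot _ lmod_pi lmod_pi_linear.

End LmodQuotient.

Section Category.
Variables (k : fieldType) (N : nat).

(* The object T_j is the ordinal j, and every Hom(T_i, T_j) is {poly k}: the
   coefficient of 'X^alpha is the coordinate on the basis vector
   a_{ji} s^alpha. *)
Local Notation ob := 'I_N.+1.
Local Notation hom := {poly k}.

Definition ob_dist (i j : ob) : nat := `|(i : int) - (j : int)|%N.

(* The truncated difference and the halving are exact: triangle inequality
   and parity. *)
Definition delta (i j l : ob) : nat := (ob_dist i j + ob_dist j l - ob_dist i l)./2.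

(* hom_comp i j l b a is the composite b . a of a : T_i -> T_j and
   b : T_j -> T_l. *)
Definition hom_comp (i j l : ob) (b a : hom) : hom := b * a * 'X^(delta i j l).

Definition term : Type := (ob * int)%type.

(* Matrices of morphisms between two lists of shifted objects, indexed by
   (target summand, source summand) *)
Definition twmat (s t : seq term) : Type :=
  {ffun 'I_(size t) * 'I_(size s) -> hom}.

Definition nth_term (s : seq term) (a : 'I_(size s)) : term :=
  tnth (in_tuple s) a.

Definition mat_of (s t : seq term) (f : term -> term -> hom) : twmat s t :=
  [ffun ba => f (nth_term ba.2) (nth_term ba.1)].

Definition tcomp (s t u : seq term) (y : twmat t u) (x : twmat s t) :
    twmat s u :=
  [ffun ca => \sum_(b < size t)
     hom_comp (nth_term ca.2).1 (nth_term b).1 (nth_term ca.1).1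
          (y (ca.1, b)) (x (b, ca.2))].

Definition homog (s t : seq term) (g : int) (x : twmat s t) : Prop :=
  forall b a, x (b, a) != 0 -> (nth_term b).2 = (nth_term a).2 + g.

Record tw := Tw {
  tw_terms :> seq term;
  tw_diff : twmat tw_terms tw_terms;
  tw_diff_homog : homog 1 tw_diff;
  tw_diff2 : tcomp tw_diff tw_diff = 0
}.

(* The degree e of the morphism x, on which the sign depends, is an explicit
   argument; likewise for the degree e of x1 in mu2. *)
Definition tw_mu1 (E F : tw) (e : int) (x : twmat E F) : twmat E F :=
  (-1) ^ e *: tcomp (tw_diff F) x - tcomp x (tw_diff E).

Definition tw_mu2 (E F G : tw) (e : int) (x2 : twmat F G) (x1 : twmat E F) :
    twmat E G :=
  (-1) ^ e *: tcomp x2 x1.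

Lemma homog0 (s t : seq term) g : homog g (0 : twmat s t).
Proof. by move=> b a; rewrite ffunE eqxx. Qed.

Lemma tcomp0 (s t u : seq term) (x : twmat s t) :
  tcomp (0 : twmat t u) x = 0.
Proof.
by apply/ffunP => -[c a]; rewrite !ffunE big1 // => b _; rewrite /hom_comp ffunE !mul0r.
Qed.

Definition tw_inj (j : ob) : tw :=
  Tw (@homog0 [:: (j, 0)] [:: (j, 0)] 1) (tcomp0 _ _).

Definition tw_inj_mor (j l : ob) (a : hom) : twmat (tw_inj j) (tw_inj l) :=
  mat_of _ _ (fun _ _ => a).

Section Braiding.
Variable i : ob.

(* Meaningful for 0 < i < N only *)
Definition prv : ob := inord i.-1.
Definition nxt : ob := inord i.+1.

Definition sgn (x y : ob) : k := (sgz ((x : int) - (y : int)))%:~R.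

Definition beta_terms (j : ob) : seq term :=
  if j == i then [:: (i, -1); (prv, 0); (nxt, 0)] else [:: (j, 0)].

Definition beta_diff (j : ob) : twmat (beta_terms j) (beta_terms j) :=
  mat_of _ _ (fun s t =>
    if (s.2 == -1) && (t.2 == 0) then
      if t.1 == prv then 1 else if t.1 == nxt then -1 else 0
    else 0).

Lemma beta_diff_homog j : homog 1 (beta_diff j).
Proof. by move=> b a; rewrite ffunE /=; case: ifP => [/andP[/eqP-> /eqP->]|_ /eqP]. Qed.

Lemma beta_diff2 j : tcomp (beta_diff j) (beta_diff j) = 0.
Proof.
apply/ffunP => -[c a]; rewrite !ffunE big1 // => b _ /=.
rewrite /hom_comp !ffunE /=; case: ifP => [/andP[/eqP-> _]|_]; last by rewrite !mul0r.
by rewrite andbF mulr0 mul0r.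
Qed.

Definition beta (j : ob) : tw := Tw (@beta_diff_homog j) (beta_diff2 j).

(* In each complex beta j the summands are pairwise distinct as pairs
   (object, degree) when 0 < i < N, so that a matrix entry can be given as a
   function of the source summand s and the target summand t. *)
Definition beta1 (j l : ob) (a : hom) : twmat (beta j) (beta l) :=
  mat_of _ _ (fun s t =>
    if j != i then
      if l != i then a
      else if t == (if (i < j)%N then nxt else prv, 0) then a else 0
    else if l != i then
      if s == (prv, 0) then if (i < l)%N then a else a * 'X
      else if s == (nxt, 0) then if (i < l)%N then a * 'X else a
      else 0
    else if s == t then a else 0).

(* beta2 j m l b a is the value on (b, a), for a : T_j -> T_m and
   b : T_m -> T_l. *)
Definition beta2 (j m l : ob) (b a : hom) : twmat (beta j) (beta l) :=
  mat_of _ _ (fun s t =>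
    let c := sgn i m *: (b * a * 'X^((ob_dist i m).-1)) in
    if (l != i) || (t != (i, -1)) then 0
    else if j != i then
      if ((i : int) - (j : int)) * ((i : int) - (m : int)) < 0 then c else 0
    else if s == (if (m < i)%N then nxt else prv, 0) then c else 0).

(* chain X Y: composable sequences T_X = X_0 -a_1-> ... -a_d-> X_d = T_Y, with
   a_1 at the head and a_d at the end *)
Inductive chain : ob -> ob -> Type :=
| cnil X : chain X X
| ccons X Z Y : hom -> chain Z Y -> chain X Y.

Fixpoint clen X Y (p : chain X Y) : nat :=
  if p is ccons _ _ _ _ q then (clen q).+1 else 0.

Fixpoint ccat X Z Y (p : chain X Z) : chain Z Y -> chain X Y :=
  match p in chain X Z return chain Z Y -> chain X Y with
  | cnil _ => id
  | ccons X W Z a q => fun r => ccons X a (ccat q r)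
  end.

(* The pairs ((a_1, ..., a_m), (a_{m+1}, ..., a_d)) for m = 0, ..., d-1 *)
Fixpoint csplits X Y (p : chain X Y) : seq {Z : ob & (chain X Z * chain Z Y)%type} :=
  match p in chain X Y
    return seq {Z : ob & (chain X Z * chain Z Y)%type} with
  | cnil _ => [::]
  | ccons X W Y a q =>
      existT _ X (cnil X, ccons X a q) ::
      [seq existT (fun Z => (chain X Z * chain Z Y)%type) (tag s)
         (ccons X a (tagged s).1, (tagged s).2) | s <- csplits q]
  end.

(* cmerge n (a_1, ..., a_d) = (a_1, ..., a_{n+2} . a_{n+1}, ..., a_d) *)
Fixpoint cmerge (n : nat) X Y (p : chain X Y) : chain X Y :=
  match p in chain X Y return chain X Y with
  | cnil X => cnil X
  | ccons X Z Y a q =>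
      if n is n'.+1 then ccons X a (cmerge n' q) else
      (match q in chain Z Y return hom -> chain X Y with
       | cnil Z => fun a => ccons X a (cnil Z)
       | ccons Z W Y b r => fun a => ccons X (hom_comp X Z W b a) r
       end) a
  end.

(* All the components beta^d, d >= 1, at once; the value on the empty chain
   is never used. *)
Definition beta_comp X Y (p : chain X Y) : twmat (beta X) (beta Y) :=
  match p in chain X Y return twmat (beta X) (beta Y) with
  | cnil _ => 0
  | ccons X Z Y a q =>
      (match q in chain Z Y return hom -> twmat (beta X) (beta Y) with
       | cnil Z => fun a => beta1 X Z a
       | ccons Z W Y b r => fun a =>
           (match r in chain W Y return hom -> twmat (beta X) (beta Y) with
            | cnil W => fun b => beta2 X Z W b a
            | ccons _ _ _ _ _ => fun _ => 0
            end) b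
       end) a
  end.

(* Families of maps of all arities d >= 0, without the multilinearity and
   degree conditions, which are in [prenat] *)
Record prefamily := Family {
  fam :> forall X Y, chain X Y -> twmat (tw_inj X) (beta Y)
}.

HB.instance Definition _ := gen_eqMixin prefamily.
HB.instance Definition _ := gen_choiceMixin prefamily.

Let fam0 : prefamily := Family (fun X Y p => 0).
Let famN (f : prefamily) : prefamily := Family (fun X Y p => - f X Y p).
Let famD (f g : prefamily) : prefamily := Family (fun X Y p => f X Y p + g X Y p).
Let famZ (c : k) (f : prefamily) : prefamily := Family (fun X Y p => c *: f X Y p).

Lemma prefamilyP (f g : prefamily) : (forall X Y p, f X Y p = g X Y p) -> f = g.
Proof.
case: f g => [f] [g] /= fg; suff -> : f = g by [].
do 3 (apply: functional_extensionality_dep => ?); exact: fg.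
Qed.

Let famDA : associative famD.
Proof. by move=> f g h; apply: prefamilyP => X Y p; apply: addrA. Qed.
Let famDC : commutative famD.
Proof. by move=> f g; apply: prefamilyP => X Y p; apply: addrC. Qed.
Let fam0D : left_id fam0 famD.
Proof. by move=> f; apply: prefamilyP => X Y p; apply: add0r. Qed.
Let famND : left_inverse fam0 famN famD.
Proof. by move=> f; apply: prefamilyP => X Y p; apply: addNr. Qed.
HB.instance Definition _ :=
  GRing.isZmodule.Build prefamily famDA famDC fam0D famND.

Let famZA c d f : famZ c (famZ d f) = famZ (c * d) f.
Proof. by apply: prefamilyP => X Y p; apply: scalerA. Qed.
Let fam1Z : left_id 1 famZ.
Proof. by move=> f; apply: prefamilyP => X Y p; apply: scale1r. Qed.
Let famZDr : right_distributive famZ +%R.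
Proof. by move=> c f g; apply: prefamilyP => X Y p; apply: scalerDr. Qed.
Let famZDl f : {morph famZ^~ f : c d / c + d}.
Proof. by move=> c d; apply: prefamilyP => X Y p; apply: scalerDl. Qed.
HB.instance Definition _ :=
  GRing.Zmodule_isLmodule.Build k prefamily famZA fam1Z famZDr famZDl.

Definition multilinear (f : prefamily) : Prop :=
  forall X Z W Y (p : chain X Z) (q : chain W Y) (c : k) (a b : hom),
    f _ _ (ccat p (ccons Z (c *: a + b) q)) =
    c *: f _ _ (ccat p (ccons Z a q)) + f _ _ (ccat p (ccons Z b q)).

Definition prenat (g : int) (f : prefamily) : Prop :=
  multilinear f /\
  forall X Y (p : chain X Y), homog (g - (clen p)%:Z) (f X Y p).

Definition nat_diff (g : int) (f : prefamily) : prefamily := Family (fun X Y p =>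
  tw_mu1 (g - (clen p)%:Z) (f X Y p)
  + \sum_(s <- csplits p)
      tw_mu2 (g - (clen (tagged s).1)%:Z)
        (beta_comp (tagged s).2) (f _ _ (tagged s).1)
  + (-1) ^ (g - 1) *:
      (match p in chain X Y return twmat (tw_inj X) (beta Y) with
       | cnil _ => 0
       | ccons X Z Y a q => tw_mu2 0 (f Z Y q) (tw_inj_mor X Z a)
       end)
  - \sum_(0 <= n < (clen p).-1) (-1) ^ (n%:Z + g - 1) *: f X Y (cmerge n p)).

Lemma tcompDl (s t u : seq term) (x : twmat s t) c (y z : twmat t u) :
  tcomp (c *: y + z) x = c *: tcomp y x + tcomp z x.
Proof.
apply/ffunP => -[d a]; rewrite !ffunE scaler_sumr -big_split /=.
by apply: eq_bigr => b _; rewrite !ffunE /hom_comp !mulrDl -!scalerAl.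
Qed.

Lemma tcompDr (s t u : seq term) (x : twmat t u) c (y z : twmat s t) :
  tcomp x (c *: y + z) = c *: tcomp x y + tcomp x z.
Proof.
apply/ffunP => -[d a]; rewrite !ffunE scaler_sumr -big_split /=.
by apply: eq_bigr => b _; rewrite !ffunE /hom_comp mulrDr mulrDl -!scalerAr -!scalerAl.
Qed.

Let scaleCC (V : lmodType k) (c d : k) (v : V) :
  c *: (d *: v) = d *: (c *: v).
Proof. by rewrite !scalerA mulrC. Qed.

Lemma nat_diff_linear g : linear (nat_diff g).
Proof.
move=> c f h; apply: prefamilyP => X Y p.
have -> : (c *: nat_diff g f + nat_diff g h) X Y p =
  c *: nat_diff g f X Y p + nat_diff g h X Y p by [].
rewrite /nat_diff /= !scalerDr !scalerN.
have L (V : zmodType) (a1 a2 a3 b1 b2 b3 c1 c2 c3 d1 d2 d3 : V) :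
    a1 = a2 + a3 -> b1 = b2 + b3 -> c1 = c2 + c3 -> d1 = d2 + d3 ->
    a1 + b1 + c1 - d1 = a2 + b2 + c2 - d2 + (a3 + b3 + c3 - d3).
  move=> -> -> -> ->; rewrite opprD (addrACA a2 a3) (addrACA (a2 + b2)).
  exact: addrACA.
apply: L.
- by rewrite /tw_mu1 tcompDr tcompDl scalerDr opprD scaleCC addrACA.
- rewrite scaler_sumr -big_split; apply: eq_bigr => s _ /=.
  by rewrite /tw_mu2 tcompDr scalerDr scaleCC.
- rewrite -(scaleCC _ c) -scalerDr; congr (_ *: _).
  case: p => [?|U Z V a q]; first by rewrite scaler0 addr0.
  by rewrite /tw_mu2 tcompDl scalerDr scaleCC.
- rewrite scaler_sumr -big_split; apply: eq_bigr => n _ /=.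
  by rewrite scalerDr scaleCC.
Qed.

Lemma prenat_submod g :
  prenat g 0 /\ forall c f h, prenat g f -> prenat g h -> prenat g (c *: f + h).
Proof.
split.
  have E U V q : (0 : prefamily) U V q = 0 by [].
  split=> [X Z W Y p q c a b|X Y p]; last by rewrite E; apply: homog0.
  by rewrite !E scaler0 addr0.
move=> c f h [mf df] [mh dh]; have E U V q :
  (c *: f + h) U V q = c *: f U V q + h U V q by [].
split=> [X Z W Y p q d a b|X Y p b a].
  by rewrite !E mf mh !scalerDr scaleCC addrACA.
rewrite E 2!ffunE; case: (eqVneq (h X Y p (b, a)) 0) => [->|/dh //].
rewrite addr0; case: (eqVneq (f X Y p (b, a)) 0) => [->|/df //].
by rewrite scaler0 eqxx.
Qed.

Definition nat_trans (g : int) (f : prefamily) : Prop :=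
  prenat g f /\ nat_diff g f = 0.

Definition exact_nat (g : int) (f : prefamily) : Prop :=
  exists2 h, prenat (g - 1) h & f = nat_diff (g - 1) h.

Definition cocycle_pred (g : int) : {pred prefamily} := [pred f | `[< nat_trans g f >]].

Lemma cocycle_submod g : submod_closed (cocycle_pred g).
Proof.
have d0 : nat_diff g 0 = 0.
  have := nat_diff_linear g 1 0 0.
  by rewrite !scale1r addr0 => /eqP; rewrite -subr_eq0 opprD addrA subrr sub0r oppr_eq0 => /eqP.
have [p0 pD] := prenat_submod g.
split; first by apply/asboolP.
move=> c f h /asboolP[pf df] /asboolP[ph dh]; apply/asboolP.
by split; [exact: pD | rewrite nat_diff_linear df dh scaler0 addr0].
Qed.
HB.instance Definition _ g :=
  GRing.isSubmodClosed.Build k prefamily (cocycle_pred g) (cocycle_submod g).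

Record cocycle (g : int) := Cocycle {
  cocycle_fam :> prefamily;
  cocycleP : cocycle_fam \in cocycle_pred g
}.
HB.instance Definition _ g := [isSub for @cocycle_fam g].
HB.instance Definition _ g := [Choice of cocycle g by <:].
HB.instance Definition _ g := [SubChoice_isSubLmodule of cocycle g by <:].

Definition coboundary_pred (g : int) : {pred cocycle g} :=
  [pred f : cocycle g | `[< exact_nat g f >]].

Lemma coboundary_submod g : submod_closed (@coboundary_pred g).
Proof.
have [p0 pD] := prenat_submod (g - 1).
have L := nat_diff_linear (g - 1).
split.
  apply/asboolP; exists 0 => //=.
  have := L 1 0 0.
  by rewrite !scale1r addr0 => /eqP; rewrite -subr_eq0 opprD addrA subrr sub0r oppr_eq0 => /eqP.
move=> c f h /asboolP[f' pf ef] /asboolP[h' ph eh]; apply/asboolP.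
by exists (c *: f' + h'); [exact: pD | rewrite L -ef -eh].
Qed.
(* The bimodule cohomology HH^g is by definition H^g Hom(id, beta). *)
Definition HH (g : int) : Type := lmod_quot (coboundary_submod g).
HB.instance Definition _ g := GRing.Lmodule.on (HH g).

Definition HH_class (g : int) (f : prefamily) (fP : nat_trans g f) : HH g :=
  lmod_pi (coboundary_submod g) (Cocycle (asboolT fP : f \in cocycle_pred g)).

(* A finitely supported sequence (eps_l)_{l >= 1} is a polynomial e with
   eps_l = e`_(l - 1), so that k^(Z_{>= 1}) is {poly k} as a vector space. *)
Definition eps (e : {poly k}) (l : nat) : k := e`_l.-1.

Definition eta (e : {poly k}) : prefamily := Family (fun X Y p =>
  match p in chain X Y return twmat (tw_inj X) (beta Y) with
  | cnil X => mat_of _ _ (fun _ t =>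
      if X != i then \sum_(1 <= l < (size e).+1) eps e l *: 'X^l
      else if (t == (prv, 0)) || (t == (nxt, 0)) then
        \sum_(1 <= l < (size e).+1) eps e l *: (2^-1 *: 'X^(l - 1))
      else 0)
  | ccons X Z Y a q =>
      (match q in chain Z Y return hom -> twmat (tw_inj X) (beta Y) with
       | cnil Z => fun a => mat_of _ _ (fun _ t =>
           if (Z == i) && (t == (i, -1)) then
             sgn i X *: \sum_(1 <= l < (size e).+1)
                          (2^-1 * eps e l) *: (a * 'X^(l - 1))
           else 0)
       | ccons _ _ _ _ _ => fun _ => 0
       end) a
  end).

End Braiding.
End Category.

Arguments HH {k N} i g.

(* Main.v *)
Require Import Defs.
From mathcomp Require Import all_boot all_order all_algebra.
From mathcomp Require Import boolp zify ring.

Set Implicit Arguments.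
Unset Strict Implicit.
Unset Printing Implicit Defensive.
Import Order.TTheory GRing.Theory Num.Theory.
Local Open Scope ring_scope.

(** Why the theorem holds. The complex beta(T_j) lives in degrees -1 and 0, and
    in degree -1 only for j = i, where its term is the shifted copy of T_i.
    Hence the component f^d of a pre-natural transformation of degree g can be
    nonzero only when g - d is 0 or -1, and every question about degree 0
    becomes finite.

    A degree 0 transformation f is given by polynomials f_j (for T_j, j <> i),
    by the two components u, v of f^0(T_i) on T_{i-1} and T_{i+1}, and by the
    values c_j(a) of f^1 on a : T_j -> T_i, which lie in the shifted T_i. With
    morphisms written as polynomials in s, being closed means in arity 1 that
    - all the f_j are equal to s (u + v);
    - c_j(a) = v a for j < i, c_j(a) = - u a for j > i, and c_i(a) = 0.
    So a cocycle is determined by the pair (u, v), which may be arbitrary. In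
    degree -1 the only datum is a polynomial w : T_i -> T_i into the shifted
    term; its differential has u = -w, v = w. Therefore the class of f is
    determined by e = u + v, and when 2 is invertible the representative with
    u = v = e / 2 is the transformation eta of the theorem, e being the
    polynomial with coefficients epsilon_1, epsilon_2, ... The map is injective
    because coboundaries vanish on every T_j with j <> i, where eta is s e.

    The equations in arity 1 are [nat_diff_away] to [nat_diff_at_nxt]; the
    degree argument that removes the other arities is [homog_nat_diff] with
    [homog_eq0]. In arity 2 there is something left to check for eta, which is
    where beta^2 enters ([eta_len2_cocycle]). The splitting of a cocycle as eta
    plus a coboundary is [cocycle_decomp]. *)

(** * Matrix entries addressed by summands *)

Section Entries.
Variables (k : fieldType) (N : nat).
Implicit Types s t u : seq (term N).

(** The list of summands of beta(T_Y) depends on whether Y is i, so positions in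
    it are dependently typed; addressing entries by the pair (object, degree)
    removes this dependency. Entries between repeated summands are added up,
    so that taking an entry is linear for all lists of summands. *)
Definition entry s t (x : twmat k s t) (b a : term N) : {poly k} :=
  \sum_(ba | (nth_term ba.1 == b) && (nth_term ba.2 == a)) x ba.

Lemma entryD s t (x y : twmat k s t) b a :
  entry (x + y) b a = entry x b a + entry y b a.
Proof. by rewrite /entry -big_split; apply: eq_bigr => p _; rewrite ffunE. Qed.

Lemma entryN s t (x : twmat k s t) b a : entry (- x) b a = - entry x b a.
Proof. by rewrite /entry -sumrN; apply: eq_bigr => p _; rewrite ffunE. Qed.

Lemma entryZ s t c (x : twmat k s t) b a : entry (c *: x) b a = c *: entry x b a.
Proof. by rewrite /entry scaler_sumr; apply: eq_bigr => p _; rewrite ffunE. Qed.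

Lemma entry0 s t b a : entry (0 : twmat k s t) b a = 0.
Proof. by rewrite /entry big1 // => p _; rewrite ffunE. Qed.

Lemma mem_nth_term s (a : 'I_(size s)) : nth_term a \in s.
Proof. exact: mem_tnth. Qed.

Lemma nth_termP s a : a \in s -> exists j : 'I_(size s), a = nth_term j.
Proof. by move/(@tnthP _ _ (in_tuple s)). Qed.

Lemma nth_term_inj s : uniq s -> injective (@nth_term N s).
Proof. by move/(@tuple_uniqP _ _ (in_tuple s)). Qed.

Lemma entry_nth s t (x : twmat k s t) b a : uniq s -> uniq t ->
  entry x (nth_term b) (nth_term a) = x (b, a).
Proof.
move=> us ut; rewrite /entry (big_pred1 (b, a)) // => -[b' a'] /=.
by rewrite !(inj_eq (nth_term_inj _)).
Qed.

Lemma entry_out s t (x : twmat k s t) b a :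
  ~~ ((b \in t) && (a \in s)) -> entry x b a = 0.
Proof.
move=> ba; rewrite /entry big1 // => p /andP[/eqP pb /eqP pa].
by rewrite -pb -pa !mem_nth_term in ba.
Qed.

Lemma entry_inj s t (x y : twmat k s t) : uniq s -> uniq t ->
  (forall b a, b \in t -> a \in s -> entry x b a = entry y b a) -> x = y.
Proof.
move=> us ut xy; apply/ffunP => -[b a].
by rewrite -!entry_nth ?xy ?mem_nth_term.
Qed.

Lemma entry_mat_of s t (f : term N -> term N -> {poly k}) b a :
  uniq s -> uniq t ->
  entry (mat_of s t f) b a = if (b \in t) && (a \in s) then f a b else 0.
Proof.
move=> us ut; case: ifPn => [/andP[]|/entry_out-> //].
by move=> /nth_termP[b' ->] /nth_termP[a' ->]; rewrite entry_nth // ffunE.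
Qed.

Lemma entry_comp s t u (y : twmat k t u) (x : twmat k s t) c a :
  uniq s -> uniq t -> uniq u ->
  entry (tcomp y x) c a =
  \sum_(b <- t) hom_comp a.1 b.1 c.1 (entry y c b) (entry x b a).
Proof.
move=> us ut uu; have [/andP[]|out] := boolP ((c \in u) && (a \in s)).
  move=> /nth_termP[c' ->] /nth_termP[a' ->].
  rewrite entry_nth // ffunE /= [RHS]big_tnth.
  by apply: eq_bigr => b _; rewrite -!entry_nth.
rewrite entry_out // big1 // => b _; rewrite /hom_comp.
have [cu|cu] := boolP (c \in u); last by rewrite [entry y _ _]entry_out ?(negPf cu) // !mul0r.
by rewrite cu /= in out; rewrite [entry x _ _]entry_out ?(negPf out) ?andbF // mulr0 mul0r.
Qed.

Lemma homog_entry s t g (x : twmat k s t) b a :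
  homog g x -> b.2 != a.2 + g -> entry x b a = 0.
Proof.
move=> hx ba; rewrite /entry big1 // => -[b' a'] /andP[/eqP /= eb /eqP /= ea].
by apply: contraNeq ba => /hx; rewrite eb ea => ->.
Qed.

Lemma homog_eq s t g h (x : twmat k s t) : homog g x -> g = h -> homog h x.
Proof. by move=> hx <-. Qed.

Lemma homogD s t g (x y : twmat k s t) : homog g x -> homog g y -> homog g (x + y).
Proof.
move=> hx hy b a; rewrite ffunE; have [->|/hx //] := eqVneq (x (b, a)) 0.
by rewrite add0r => /hy.
Qed.

Lemma homogZ s t g c (x : twmat k s t) : homog g x -> homog g (c *: x).
Proof.
move=> hx b a; rewrite ffunE; have [->|/hx //] := eqVneq (x (b, a)) 0.
by rewrite scaler0 eqxx.
Qed.

Lemma homogN s t g (x : twmat k s t) : homog g x -> homog g (- x).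
Proof. by rewrite -scaleN1r => ?; apply: homogZ. Qed.

Lemma homog_sum s t g I (r : seq I) (F : I -> twmat k s t) :
  (forall j, homog g (F j)) -> homog g (\sum_(j <- r) F j).
Proof. by move=> hF; elim/big_ind: _ => // [|x y]; [apply: homog0 | apply: homogD]. Qed.

Lemma homog_comp s t u g h (y : twmat k t u) (x : twmat k s t) :
  homog g x -> homog h y -> homog (g + h) (tcomp y x).
Proof.
move=> hx hy c a; rewrite ffunE; apply: contraNeq => ca.
rewrite big1 // => b _; rewrite /hom_comp.
have [->|/hx eb] := eqVneq (x (b, a)) 0; first by rewrite mulr0 mul0r.
have [->|/hy ec] := eqVneq (y (c, b)) 0; first by rewrite !mul0r.
by rewrite ec eb addrA eqxx in ca.
Qed.
End Entries.

(** * Degrees *)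

Section Degrees.
Variables (k : fieldType) (N : nat) (i : 'I_N.+1).
Local Notation hom := {poly k}.
Local Notation P := (prv i).
Local Notation Q := (nxt i).

Lemma homog_mat_of (s t : seq (term N)) g (f : term N -> term N -> hom) :
  (forall a b, a \in s -> b \in t -> f a b != 0 -> b.2 = a.2 + g) ->
  homog g (mat_of s t f).
Proof. by move=> hf b a; rewrite ffunE => /hf -> //; apply: mem_nth_term. Qed.

Lemma mem_beta_terms Y b : (b \in beta_terms i Y) =
  if Y == i then [|| b == (i, -1), b == (P, 0) | b == (Q, 0)] else b == (Y, 0).
Proof. by rewrite /beta_terms; case: ifP => _; rewrite !inE. Qed.

Lemma beta_terms_deg Y b : b \in beta_terms i Y -> b.2 = 0 \/ b.2 = -1.
Proof.
by rewrite mem_beta_terms; case: ifP => _; [case/or3P|]; move/eqP->; auto.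
Qed.

Lemma homog_beta1 j l (a : hom) : homog 0 (beta1 i j l a).
Proof.
apply: homog_mat_of => s t; rewrite addr0 !mem_beta_terms.
case: (eqVneq j i) => _ /=; case: (eqVneq l i) => _ /=.
- by move=> _ _; case: (eqVneq s) => [->|_]; rewrite ?eqxx.
- move=> _ /eqP -> /=; case: (eqVneq s (P, 0)) => [->|_] //.
  by case: (eqVneq s) => [->|_]; rewrite ?eqxx.
- by move=> /eqP -> _; case: (eqVneq t) => [->|_]; rewrite ?eqxx.
- by move=> /eqP -> /eqP ->.
Qed.

Lemma homog_beta2 j m l (b a : hom) : homog (- 1) (beta2 i j m l b a).
Proof.
apply: homog_mat_of => s t; rewrite !mem_beta_terms => smem _ /=.
case: (eqVneq l i) => _ /=; last by rewrite eqxx.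
case: (eqVneq t _) => [->|_] /=; last by rewrite eqxx.
case: (eqVneq j i) smem => _ /= smem; last by rewrite (eqP smem).
by case: (eqVneq s) => [->|_]; rewrite ?eqxx.
Qed.

Lemma homog_beta_comp X Y (p : chain k X Y) :
  homog (1 - (clen p)%:Z) (beta_comp i p).
Proof.
case: p => [Z|U Z V a q]; first exact: homog0.
case: q a => [W|W1 W2 W3 b q] a; first exact: homog_beta1.
case: q b => [W|W4 W5 W6 c q] b; first exact: homog_beta2.
exact: homog0.
Qed.

Lemma homog_tw_inj_mor j l (a : hom) : homog 0 (tw_inj_mor (N := N) j l a).
Proof. by apply: homog_mat_of => s t; rewrite !inE => /eqP-> /eqP->. Qed.

(** The splittings are dependent pairs without decidable equality; the condition
    on lengths replaces membership in the list of splittings. *)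
Lemma homog_csplits X Y (p : chain k X Y) (E F : seq (term N)) g
    (G : {Z : 'I_N.+1 & (chain k X Z * chain k Z Y)%type} -> twmat k E F) :
  (forall s, (clen (tagged s).1 + clen (tagged s).2 = clen p)%N -> homog g (G s)) ->
  homog g (\sum_(s <- csplits p) G s).
Proof.
elim: p G => [Z|U Z V a q IH] G hG /=; first by rewrite big_nil; apply: homog0.
rewrite big_cons big_map; apply: homogD; first exact: hG.
by apply: IH => s es; apply: hG; rewrite /= -es.
Qed.

Lemma clen_cmerge n (X Y : 'I_N.+1) (p : chain k X Y) :
  (n < (clen p).-1)%N -> clen (cmerge n p) = (clen p).-1.
Proof.
elim: p n => [//|U Z V a q IH] [|n] /=; first by case: q a {IH}.
by move=> lt_n; rewrite IH; lia.
Qed.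

(** Every term of the differential has this degree because beta^m has degree
    1 - m, and the composition of two arguments has degree 0. *)
Lemma homog_nat_diff g f X Y (p : chain k X Y) : prenat (i := i) g f ->
  homog (g + 1 - (clen p)%:Z) (nat_diff g f X Y p).
Proof.
case=> _ hf; rewrite /nat_diff /=.
apply: homogD; last first.
  apply: homogN; rewrite big_mkord; apply: homog_sum => n; apply: homogZ.
  by apply: (homog_eq (hf _ _ _)); rewrite clen_cmerge //; case: n => /=; lia.
apply: homogD; first apply: homogD.
- apply: homogD.
    apply: homogZ; apply: (homog_eq (homog_comp (hf _ _ _) (@beta_diff_homog k N i Y))); lia.
  by apply: homogN => b a; rewrite ffunE big1 ?eqxx // => c _; rewrite /hom_comp ffunE mulr0 mul0r.
- apply: homog_csplits => s es; apply: homogZ.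
  apply: (homog_eq (homog_comp (hf _ _ _) (@homog_beta_comp _ _ _))); lia.
apply: homogZ; case: p => [Z|U Z V a q]; first exact: homog0.
by apply: homogZ; apply: (homog_eq (homog_comp (@homog_tw_inj_mor _ _ _) (hf _ _ _))) => /=; lia.
Qed.

(** The terms of beta(T_Y) have degrees 0 and -1 only; in combination with the
    degree of the differential, this leaves only small arities to check. *)
Lemma homog_eq0 X Y g (x : twmat k (tw_inj k X) (beta k i Y)) :
  g != 0 -> g != - 1 -> homog g x -> x = 0.
Proof.
move=> g0 g1 hx; apply/ffunP => -[b a]; rewrite ffunE; apply: contraNeq g0 => /hx.
have := mem_nth_term a; rewrite inE => /eqP -> /=; rewrite add0r.
by case: (beta_terms_deg (mem_nth_term b)) => -> e; rewrite -e ?eqxx // in g1 *.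
Qed.
End Degrees.

(** * The differential in small arities *)

Section SmallArity.
Variables (k : fieldType) (N : nat) (i : 'I_N.+1).
Local Notation hom := {poly k}.

Lemma tcompr0 (s t u : seq (term N)) (y : twmat k t u) :
  tcomp y (0 : twmat k s t) = 0.
Proof.
by apply/ffunP => -[c a]; rewrite !ffunE big1 // => b _; rewrite /hom_comp ffunE mulr0 mul0r.
Qed.

Variable f : prefamily k i.

Lemma nat_diffN_nil X :
  nat_diff (-1) f X X (cnil k X) = - tcomp (beta_diff k i X) (f X X (cnil k X)).
Proof.
rewrite /nat_diff /= big_nil big_geq // subr0 scaler0 !addr0 /tw_mu1 /= tcompr0.
by rewrite !subr0 exprN1 invrN1 scaleN1r.
Qed.

Lemma nat_diff_len1 X Y (a : hom) :
  nat_diff 0 f X Y (ccons X a (cnil k Y)) =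
  - tcomp (beta_diff k i Y) (f X Y (ccons X a (cnil k Y)))
  + tcomp (beta1 i X Y a) (f X X (cnil k X))
  - tcomp (f Y Y (cnil k Y)) (tw_inj_mor X Y a).
Proof.
rewrite /nat_diff /= big_seq1 big_geq // subr0 /tw_mu1 /tw_mu2 /= tcompr0.
by rewrite subr0 !sub0r oppr0 expr0z !scale1r exprN1 invrN1 !scaleN1r.
Qed.

Lemma nat_diffN_len1 X Y (a : hom) :
  nat_diff (-1) f X Y (ccons X a (cnil k Y)) =
  tcomp (beta_diff k i Y) (f X Y (ccons X a (cnil k Y)))
  - tcomp (beta1 i X Y a) (f X X (cnil k X))
  + tcomp (f Y Y (cnil k Y)) (tw_inj_mor X Y a).
Proof.
rewrite /nat_diff /= big_seq1 big_geq // subr0 /tw_mu1 /tw_mu2 /= tcompr0.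
have s2 : (-1 : k) ^ (- 2%:Z) = 1 by rewrite -exprnN sqrrN expr1n invr1.
rewrite !subr0 exprN1 invrN1 !scaleN1r expr0z scale1r.
by rewrite -![(-1) ^ (-1 - _)]/((-1 : k) ^ (- 2%:Z)) s2 !scale1r.
Qed.

Lemma nat_diff_len2 X Y Z (a b : hom) :
  nat_diff 0 f X Z (ccons X a (ccons Y b (cnil k Z))) =
  tcomp (beta_diff k i Z) (f X Z (ccons X a (ccons Y b (cnil k Z))))
  + tcomp (beta2 i X Y Z b a) (f X X (cnil k X))
  - tcomp (beta1 i Y Z b) (f X Y (ccons X a (cnil k Y)))
  - tcomp (f Y Z (ccons Y b (cnil k Z))) (tw_inj_mor X Y a)
  + f X Z (ccons X (hom_comp X Y Z b a) (cnil k Z)).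
Proof.
rewrite /nat_diff /= big_cons big_seq1 big_nat1 /tw_mu1 /tw_mu2 /= tcompr0.
rewrite !subr0 !sub0r expr0z !scale1r exprN1 invrN1 !scaleN1r opprK.
have s2 : (-1 : k) ^ (- 2%:Z) = 1 by rewrite -exprnN sqrrN expr1n invr1.
by rewrite -[(-1) ^ (- _)]/((-1 : k) ^ (- 2%:Z)) s2 scale1r addrA.
Qed.

End SmallArity.

(** * Composition with the components of the braiding functor *)

Section EntryFormulas.
Variables (k : fieldType) (N : nat) (i : 'I_N.+1).
Hypotheses (i_gt0 : (0 < i)%N) (i_ltN : (i < N)%N).
Local Notation hom := {poly k}.
Local Notation P := (prv i).
Local Notation Q := (nxt i).

Lemma prvE : P = i.-1 :> nat. Proof. by rewrite inordK //; lia. Qed.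
Lemma nxtE : Q = i.+1 :> nat. Proof. by rewrite inordK //; lia. Qed.
Lemma prv_neq_nxt : P != Q. Proof. by rewrite -val_eqE /= prvE nxtE; lia. Qed.
Lemma prv_neq : P != i. Proof. by rewrite -val_eqE /= prvE; lia. Qed.

Lemma uniq_beta_terms Y : uniq (beta_terms i Y).
Proof.
rewrite /beta_terms; case: ifP => _ //=.
by rewrite !inE !xpair_eqE (negPf prv_neq_nxt) /= !andbF.
Qed.

Lemma sum_beta_terms (V : zmodType) Y (F : term N -> V) :
  \sum_(b <- beta_terms i Y) F b =
  if Y == i then F (i, -1) + (F (P, 0) + F (Q, 0)) else F (Y, 0).
Proof. by rewrite /beta_terms; case: ifP => _; rewrite !big_cons big_nil !addr0. Qed.

Lemma twmat_ext X Y (x y : twmat k (tw_inj k X) (beta k i Y)) :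
  (forall t, t \in beta_terms i Y -> entry x t (X, 0) = entry y t (X, 0)) -> x = y.
Proof.
move=> xy; apply: entry_inj => //; first exact: uniq_beta_terms.
by move=> b a hb; rewrite inE => /eqP ->; apply: xy.
Qed.

Lemma entry_precomp W X Y (x : twmat k (tw_inj k X) (beta k i Y)) (a : hom) t :
  entry (tcomp x (tw_inj_mor W X a)) t (W, 0) =
  hom_comp W X t.1 (entry x t (X, 0)) a.
Proof.
rewrite entry_comp ?uniq_beta_terms // big_seq1 entry_mat_of //.
by rewrite !inE !eqxx.
Qed.

Lemma entry_diff W Y (x : twmat k (tw_inj k W) (beta k i Y)) t :
  t \in beta_terms i Y ->
  entry (tcomp (beta_diff k i Y) x) t (W, 0) =
  if (Y == i) && (t.2 == 0) then
    hom_comp W i t.1 (if t.1 == P then 1 else -1) (entry x (i, -1) (W, 0))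
  else 0.
Proof.
move=> ht; rewrite entry_comp ?uniq_beta_terms // sum_beta_terms.
have E b : b \in beta_terms i Y -> entry (beta_diff k i Y) t b =
    if (b.2 == -1) && (t.2 == 0) then
      if t.1 == P then 1 else if t.1 == Q then -1 else 0 else 0.
  by move=> hb; rewrite entry_mat_of ?uniq_beta_terms // ht hb.
case: (eqVneq Y i) x ht E => [->|Yi] x ht E.
  rewrite !E ?mem_beta_terms ?eqxx ?orbT //= /hom_comp !mul0r !addr0.
  move: ht; rewrite mem_beta_terms eqxx => /or3P[]/eqP-> /=; rewrite ?eqxx ?mul0r //.
by rewrite !E ?mem_beta_terms ?(negPf Yi) ?eqxx // /hom_comp !mul0r.
Qed.

Section Beta1.
Variables (W : 'I_N.+1) (a : hom).

Lemma entry_beta1_away X Y (x : twmat k (tw_inj k W) (beta k i X)) :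
  X != i -> Y != i ->
  entry (tcomp (beta1 i X Y a) x) (Y, 0) (W, 0) =
  hom_comp W X Y a (entry x (X, 0) (W, 0)).
Proof.
move=> Xi Yi; rewrite entry_comp ?uniq_beta_terms // sum_beta_terms (negPf Xi).
by rewrite entry_mat_of ?uniq_beta_terms // !mem_beta_terms (negPf Xi) (negPf Yi) !eqxx.
Qed.

Lemma entry_beta1_into X (x : twmat k (tw_inj k W) (beta k i X)) t :
  X != i -> t \in beta_terms i i ->
  entry (tcomp (beta1 i X i a) x) t (W, 0) =
  if t == (if (i < X)%N then Q else P, 0)
  then hom_comp W X t.1 a (entry x (X, 0) (W, 0)) else 0.
Proof.
move=> Xi ht; rewrite entry_comp ?uniq_beta_terms // sum_beta_terms (negPf Xi).
rewrite entry_mat_of ?uniq_beta_terms // ht mem_beta_terms (negPf Xi) !eqxx /=.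
by case: ifP => // _; rewrite /hom_comp !mul0r.
Qed.

Lemma entry_beta1_from Y (x : twmat k (tw_inj k W) (beta k i i)) :
  Y != i ->
  entry (tcomp (beta1 i i Y a) x) (Y, 0) (W, 0) =
  hom_comp W P Y (if (i < Y)%N then a else a * 'X) (entry x (P, 0) (W, 0)) +
  hom_comp W Q Y (if (i < Y)%N then a * 'X else a) (entry x (Q, 0) (W, 0)).
Proof.
move=> Yi; rewrite entry_comp ?uniq_beta_terms // sum_beta_terms eqxx.
rewrite !entry_mat_of ?uniq_beta_terms // !mem_beta_terms (negPf Yi) !eqxx !orbT /=.
rewrite !xpair_eqE !eqxx /= (eq_sym Q) (negPf prv_neq_nxt) !andbF /=.
by rewrite /hom_comp !mul0r add0r.
Qed.

Lemma entry_beta1_at (x : twmat k (tw_inj k W) (beta k i i)) t :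
  t \in beta_terms i i ->
  entry (tcomp (beta1 i i i a) x) t (W, 0) =
  hom_comp W t.1 t.1 a (entry x t (W, 0)).
Proof.
move=> ht; rewrite entry_comp ?uniq_beta_terms //.
rewrite (bigD1_seq t) ?uniq_beta_terms //= big_seq_cond big1 ?addr0.
  by rewrite entry_mat_of ?uniq_beta_terms // ht !eqxx.
move=> b /andP[hb bt].
by rewrite entry_mat_of ?uniq_beta_terms // ht hb !eqxx /= (negPf bt) /hom_comp !mul0r.
Qed.
End Beta1.

Lemma entry_beta2_away X Y (b a : hom) (x : twmat k (tw_inj k X) (beta k i X)) :
  X != i ->
  entry (tcomp (beta2 i X Y i b a) x) (i, -1) (X, 0) =
  hom_comp X X i
    (if ((i : int) - (X : int)) * ((i : int) - (Y : int)) < 0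
     then sgn k i Y *: (b * a * 'X^((ob_dist i Y).-1)) else 0)
    (entry x (X, 0) (X, 0)).
Proof.
move=> Xi; rewrite entry_comp ?uniq_beta_terms // sum_beta_terms (negPf Xi).
by rewrite entry_mat_of ?uniq_beta_terms // !mem_beta_terms (negPf Xi) !eqxx.
Qed.

Lemma entry_beta2_at Y (b a : hom) (x : twmat k (tw_inj k i) (beta k i i)) :
  entry (tcomp (beta2 i i Y i b a) x) (i, -1) (i, 0) =
  let s := if (Y < i)%N then Q else P in
  hom_comp i s i (sgn k i Y *: (b * a * 'X^((ob_dist i Y).-1)))
    (entry x (s, 0) (i, 0)).
Proof.
rewrite entry_comp ?uniq_beta_terms // sum_beta_terms eqxx.
rewrite !entry_mat_of ?uniq_beta_terms // !mem_beta_terms !eqxx !orbT /=.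
rewrite !xpair_eqE !eqxx /= !andbT !andbF /=.
case: (ltnP Y i) => _; rewrite ?eqxx ?(negPf prv_neq_nxt) ?(eq_sym Q P) ?(negPf prv_neq_nxt);
  by rewrite /hom_comp !mul0r ?add0r ?addr0.
Qed.

End EntryFormulas.

(** * The exponent delta *)

Section Delta.
Variable N : nat.
Implicit Types x y z : 'I_N.+1.

Lemma delta_xxy x y : delta x x y = 0.
Proof. rewrite /delta /ob_dist; lia. Qed.
Lemma delta_xyy x y : delta x y y = 0.
Proof. rewrite /delta /ob_dist; lia. Qed.
Lemma delta_between x y z : (x <= y <= z)%N || (z <= y <= x)%N -> delta x y z = 0.
Proof. rewrite /delta /ob_dist; lia. Qed.
Lemma delta_beyond x y z : (x <= z <= y)%N || (y <= z <= x)%N -> delta x y z = ob_dist z y.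
Proof. rewrite /delta /ob_dist; lia. Qed.
Lemma delta_back x y z : (y <= x <= z)%N || (z <= x <= y)%N -> delta x y z = ob_dist x y.
Proof. rewrite /delta /ob_dist; lia. Qed.
Lemma ob_dist_sym x y : ob_dist x y = ob_dist y x.
Proof. rewrite /ob_dist; lia. Qed.

End Delta.

(** * Cocycle equations in degree 0 *)

Section DegreeZero.
Variables (k : fieldType) (N : nat) (i : 'I_N.+1).
Hypotheses (i_gt0 : (0 < i)%N) (i_ltN : (i < N)%N).
Local Notation hom := {poly k}.
Local Notation P := (prv i).
Local Notation Q := (nxt i).
Let PE := prvE i_gt0 i_ltN.
Let QE := nxtE i_ltN.

Lemma dist_prv : ob_dist i P = 1%N. Proof. rewrite /ob_dist PE; lia. Qed.
Lemma dist_nxt : ob_dist i Q = 1%N. Proof. rewrite /ob_dist QE; lia. Qed.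
Lemma mem_beta_away Y : Y != i -> (Y, 0) \in beta_terms i Y.
Proof. by move=> Yi; rewrite mem_beta_terms (negPf Yi). Qed.
Lemma mem_shifted : (i, -1) \in beta_terms i i.
Proof. by rewrite mem_beta_terms !eqxx. Qed.
Lemma mem_prv : (P, 0) \in beta_terms i i.
Proof. by rewrite mem_beta_terms !eqxx orbT. Qed.
Lemma mem_nxt : (Q, 0) \in beta_terms i i.
Proof. by rewrite mem_beta_terms !eqxx !orbT. Qed.
Let QP : (Q == P) = false. Proof. by rewrite (eq_sym Q) (negPf (prv_neq_nxt i_gt0 i_ltN)). Qed.

(** In arity 1 the differential of a degree 0 transformation has degree 0, so it
    is enough to look at the degree 0 summands of beta(T_Y). *)
Section Len1.
Variables (f : prefamily k i) (a : hom).
Local Notation f0 X := (entry (f X X (cnil k X)) (X, 0) (X, 0)).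
Local Notation fP := (entry (f i i (cnil k i)) (P, 0) (i, 0)).
Local Notation fQ := (entry (f i i (cnil k i)) (Q, 0) (i, 0)).
Local Notation f1 X := (entry (f X i (ccons X a (cnil k i))) (i, -1) (X, 0)).
Local Notation D X Y t := (entry (nat_diff 0 f X Y (ccons X a (cnil k Y))) t (X, 0)).

Lemma nat_diff_away X Y : X != i -> Y != i -> D X Y (Y, 0) = a * f0 X - f0 Y * a.
Proof.
move=> Xi Yi; rewrite nat_diff_len1 !(entryD, entryN) entry_precomp //.
rewrite entry_beta1_away // entry_diff ?mem_beta_away // (negPf Yi) /=.
by rewrite /hom_comp !(delta_xxy, delta_xyy) /= !expr0; ring.
Qed.

(** Either way around, exactly one of the two routes T_i -> T_{i-1} -> T_Y and
    T_i -> T_{i+1} -> T_Y turns back and so costs a factor s; beta^1 supplies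
    the same factor on the other route. This is why only u + v is seen. *)
Lemma nat_diff_from Y : Y != i -> D i Y (Y, 0) = a * ('X * (fP + fQ)) - f0 Y * a.
Proof.
move=> Yi; rewrite nat_diff_len1 !(entryD, entryN) entry_precomp //.
rewrite entry_beta1_from // entry_diff ?mem_beta_away // (negPf Yi) /=.
rewrite /hom_comp !(delta_xxy, delta_xyy) /=.
case: (ltngtP Y i) => [Ylt|Ygt|/val_inj Ye]; last by rewrite Ye eqxx in Yi.
  rewrite [delta _ P _]delta_between ?PE; last lia.
  by rewrite [delta _ Q _]delta_back ?dist_nxt ?QE ?expr0 ?expr1; [ring|lia].
rewrite [delta _ Q _]delta_between ?QE; last lia.
by rewrite [delta _ P _]delta_back ?dist_prv ?PE ?expr0 ?expr1; [ring|lia].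
Qed.

(** For X < i the path T_X -> T_i -> T_{i-1} turns back, whence the factor 'X in
    the terms that pass through T_i; the path on to T_{i+1} does not. For X > i
    the roles of the two neighbours are exchanged. *)
Lemma nat_diff_below_prv (X : 'I_N.+1) : (X < i)%N ->
  D X i (P, 0) = - (f1 X * 'X) + a * f0 X - fP * a * 'X.
Proof.
move=> Xi; have Xn : X != i by rewrite -val_eqE /=; lia.
rewrite nat_diff_len1 !(entryD, entryN) entry_precomp //.
rewrite entry_beta1_into ?mem_prv // entry_diff ?mem_prv //= !eqxx /=.
rewrite (ltnNge i X) ltnW //= eqxx /hom_comp !(delta_xxy, delta_xyy) /=.
rewrite [delta X i P]delta_beyond ?PE; last lia.
by rewrite ob_dist_sym dist_prv expr0 expr1; ring.
Qed.

Lemma nat_diff_below_nxt (X : 'I_N.+1) : (X < i)%N -> D X i (Q, 0) = f1 X - fQ * a.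
Proof.
move=> Xi; have Xn : X != i by rewrite -val_eqE /=; lia.
rewrite nat_diff_len1 !(entryD, entryN) entry_precomp //.
rewrite entry_beta1_into ?mem_nxt // entry_diff ?mem_nxt //= !eqxx /=.
rewrite (ltnNge i X) ltnW //= !xpair_eqE QP /= /hom_comp.
rewrite [delta X i Q]delta_between ?QE; last lia.
by rewrite expr0; ring.
Qed.

Lemma nat_diff_above_nxt (X : 'I_N.+1) : (i < X)%N ->
  D X i (Q, 0) = f1 X * 'X + a * f0 X - fQ * a * 'X.
Proof.
move=> Xi; have Xn : X != i by rewrite -val_eqE /=; lia.
rewrite nat_diff_len1 !(entryD, entryN) entry_precomp //.
rewrite entry_beta1_into ?mem_nxt // entry_diff ?mem_nxt //= !eqxx /=.
rewrite Xi eqxx QP /hom_comp !(delta_xxy, delta_xyy) /=.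
rewrite [delta X i Q]delta_beyond ?QE; last lia.
by rewrite ob_dist_sym dist_nxt expr0 expr1; ring.
Qed.

Lemma nat_diff_above_prv (X : 'I_N.+1) : (i < X)%N -> D X i (P, 0) = - f1 X - fP * a.
Proof.
move=> Xi; have Xn : X != i by rewrite -val_eqE /=; lia.
rewrite nat_diff_len1 !(entryD, entryN) entry_precomp //.
rewrite entry_beta1_into ?mem_prv // entry_diff ?mem_prv //= !eqxx /=.
rewrite Xi !xpair_eqE (eq_sym P) QP /= /hom_comp.
rewrite [delta X i P]delta_between ?PE; last lia.
by rewrite expr0; ring.
Qed.

Lemma nat_diff_at_prv : D i i (P, 0) = - f1 i.
Proof.
rewrite nat_diff_len1 !(entryD, entryN) entry_precomp //.
rewrite entry_beta1_at ?mem_prv // entry_diff ?mem_prv //= !eqxx /=.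
by rewrite /hom_comp !(delta_xxy, delta_xyy) expr0; ring.
Qed.

Lemma nat_diff_at_nxt : D i i (Q, 0) = f1 i.
Proof.
rewrite nat_diff_len1 !(entryD, entryN) entry_precomp //.
rewrite entry_beta1_at ?mem_nxt // entry_diff ?mem_nxt //= !eqxx /= QP.
by rewrite /hom_comp !(delta_xxy, delta_xyy) expr0; ring.
Qed.
End Len1.

(** * The transformation eta *)

Section Eta.
Variable e : {poly k}.
Local Notation h := (2^-1 *: e).

Lemma sum_eps (F : nat -> hom) :
  \sum_(1 <= l < (size e).+1) eps e l *: F l = \sum_(l < size e) e`_l *: F l.+1.
Proof. by rewrite big_add1 big_mkord. Qed.

Lemma sum_coefX : \sum_(l < size e) e`_l *: 'X^l = e.
Proof. by rewrite -poly_def coefK. Qed.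

Lemma eta_nil_away X : X != i ->
  entry (eta i e X X (cnil k X)) (X, 0) (X, 0) = e * 'X.
Proof.
move=> Xi; rewrite entry_mat_of ?uniq_beta_terms // mem_beta_terms (negPf Xi).
rewrite eqxx inE eqxx /= sum_eps -[e in RHS]sum_coefX mulr_suml.
by apply: eq_bigr => l _; rewrite exprSr scalerAl.
Qed.

Lemma eta_nil_at t : t \in [:: (P, 0); (Q, 0)] ->
  entry (eta i e i i (cnil k i)) t (i, 0) = h.
Proof.
move=> ht; rewrite entry_mat_of ?uniq_beta_terms // mem_beta_terms !inE eqxx.
move: ht; rewrite !inE => ht; rewrite ht orbT eqxx /= sum_eps -[e in RHS]sum_coefX scaler_sumr.
by apply: eq_bigr => l _; rewrite subn1 /= scalerA mulrC scalerA.
Qed.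

Lemma eta_len1 X (a : hom) :
  entry (eta i e X i (ccons X a (cnil k i))) (i, -1) (X, 0) = sgn k i X *: (a * h).
Proof.
rewrite entry_mat_of ?uniq_beta_terms // mem_beta_terms !inE !eqxx /=.
congr (_ *: _); rewrite big_add1 big_mkord -[e in RHS]sum_coefX !scaler_sumr mulr_sumr.
by apply: eq_bigr => l _; rewrite subn1 /= scalerA scalerAr.
Qed.

Lemma eta_multilinear : multilinear (eta i e).
Proof.
move=> X Z W Y p q c a b.
case: p q => [U|U V T d p] q /=.
  case: q => [T|T U' V' d q] /=; last by rewrite scaler0 addr0.
  apply/ffunP => ta; rewrite !ffunE; case: ifP => _; last by rewrite scaler0 addr0.
  rewrite scalerA mulrC -scalerA -scalerDr; congr (_ *: _).
  rewrite scaler_sumr -big_split; apply: eq_bigr => l _ /=.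
  by rewrite mulrDl scalerDr -scalerAl !scalerA mulrC.
by case: p q => [T'|T' U' V' d' p] q /=; rewrite scaler0 addr0.
Qed.

Lemma eta_homog X Y (p : chain k X Y) : homog (0 - (clen p)%:Z) (eta i e X Y p).
Proof.
case: p => [U|U V T a q] /=.
  apply: homog_mat_of => s t; rewrite !inE => /eqP -> /=.
  rewrite mem_beta_terms; case: (eqVneq U i) => /= [_ _|_ /eqP -> //].
  case: ifP; last by rewrite eqxx.
  by case/orP => /eqP ->.
case: q a => [U' a|U' V' T' b q a] /=; last exact: homog0.
apply: homog_mat_of => s t; rewrite !inE => /eqP -> /= _.
by case: ifP => [/andP[_ /eqP ->]|]; rewrite ?eqxx.
Qed.

Lemma eta_prenat : prenat 0 (eta i e).
Proof. by split; [apply: eta_multilinear | apply: eta_homog]. Qed.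
End Eta.

End DegreeZero.

(** * Classification of the classes of degree 0 *)

Section Cohomology.
Variables (k : fieldType) (N : nat) (i : 'I_N.+1).
Hypotheses (i_gt0 : (0 < i)%N) (i_ltN : (i < N)%N).
Hypothesis two_neq0 : (2 : k) != 0.
Local Notation hom := {poly k}.
Local Notation P := (prv i).
Local Notation Q := (nxt i).
Let PE := prvE i_gt0 i_ltN.
Let QE := nxtE i_ltN.

Lemma half_double (e : hom) : 2^-1 *: e + 2^-1 *: e = e.
Proof. by rewrite -scalerDl (_ : 2^-1 + 2^-1 = 1) ?scale1r //; field. Qed.

Lemma sgn_lt (x y : 'I_N.+1) : (y < x)%N -> sgn k x y = 1.
Proof. by move=> yx; rewrite /sgn gtr0_sgz //; lia. Qed.
Lemma sgn_gt (x y : 'I_N.+1) : (x < y)%N -> sgn k x y = -1.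
Proof. by move=> yx; rewrite /sgn ltr0_sgz ?mulrN1z //; lia. Qed.
Lemma sgn_eq (x : 'I_N.+1) : sgn k x x = 0.
Proof. by rewrite /sgn subrr sgz0. Qed.

(** The equations for (u, v) hold with u = v = h and f_j = s (h + h), where h is
    half of e. *)
Lemma eta_len1_cocycle (e : hom) X Y (a : hom) :
  nat_diff 0 (eta i e) X Y (ccons X a (cnil k Y)) = 0.
Proof.
apply: (twmat_ext i_gt0 i_ltN) => t; rewrite entry0.
have H := @homog_nat_diff _ _ _ _ _ _ _ (ccons X a (cnil k Y)) (eta_prenat i e).
have eP : entry (eta i e i i (cnil k i)) (P, 0) (i, 0) = 2^-1 *: e.
  by rewrite eta_nil_at // !inE eqxx.
have eQ : entry (eta i e i i (cnil k i)) (Q, 0) (i, 0) = 2^-1 *: e.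
  by rewrite eta_nil_at // !inE eqxx orbT.
have E2 := half_double e; set h := 2^-1 *: e in eP eQ E2.
case: (eqVneq Y i) H => [->|Yi] H.
  rewrite mem_beta_terms eqxx => /or3P[] /eqP ->.
  - by rewrite (homog_entry H).
  - case: (ltngtP X i) => [Xi|Xi|/val_inj ->].
    + have Xn : X != i by rewrite -val_eqE /=; lia.
      rewrite nat_diff_below_prv // eP eta_nil_away // eta_len1 // sgn_lt // scale1r.
      by rewrite -/h -E2; ring.
    + rewrite nat_diff_above_prv // eP eta_len1 // sgn_gt // scaleN1r -/h; ring.
    + by rewrite nat_diff_at_prv // eta_len1 // sgn_eq scale0r oppr0.
  - case: (ltngtP X i) => [Xi|Xi|/val_inj ->].
    + rewrite nat_diff_below_nxt // eQ eta_len1 // sgn_lt // scale1r -/h; ring.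
    + have Xn : X != i by rewrite -val_eqE /=; lia.
      rewrite nat_diff_above_nxt // eQ eta_nil_away // eta_len1 // sgn_gt // scaleN1r.
      by rewrite -/h -E2; ring.
    + by rewrite nat_diff_at_nxt // eta_len1 // sgn_eq scale0r.
rewrite mem_beta_terms (negPf Yi) => /eqP ->.
case: (eqVneq X i) => [->|Xi].
  by rewrite nat_diff_from // eP eQ eta_nil_away // -E2; ring.
by rewrite nat_diff_away // !eta_nil_away //; ring.
Qed.

(** Only the entry in the shifted T_i matters. If T_X and T_Y lie on the same side
    of T_i, or if Y = i, the terms with eta^1 cancel. If T_i lies strictly
    between them, the two terms with eta^1 add up instead, and the beta^2 term,
    evaluated on eta^0(T_X) = 2 h s, compensates them. For X = i and Y <> i a
    single term with eta^1 survives, and beta^2 is evaluated on one component h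
    of eta^0(T_i). *)
Lemma eta_len2_cocycle (e : hom) X Y Z (a b : hom) :
  nat_diff 0 (eta i e) X Z (ccons X a (ccons Y b (cnil k Z))) = 0.
Proof.
apply: (twmat_ext i_gt0 i_ltN) => t tZ; rewrite entry0.
have H := @homog_nat_diff _ _ _ _ _ _ _ (ccons X a (ccons Y b (cnil k Z))) (eta_prenat i e).
case: (eqVneq Z i) tZ H => [->|Zi] tZ H; last first.
  by move: tZ; rewrite mem_beta_terms (negPf Zi) => /eqP ->; rewrite (homog_entry H).
move: tZ; rewrite mem_beta_terms eqxx => /or3P[] /eqP ->;
  try by rewrite (homog_entry H).
rewrite nat_diff_len2 !(entryD, entryN) entry_precomp //.
rewrite [X in X + _ - _ - _ + _](_ : _ = 0); last first.
  by rewrite /= tcompr0 entry0.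
rewrite !eta_len1 //.
have E2 := half_double e; set h := 2^-1 *: e in E2 *.
have B1 : entry (tcomp (beta1 i Y i b) (eta i e X Y (ccons X a (cnil k Y)))) (i, -1) (X, 0)
    = if Y == i then sgn k i X *: (b * a * h) else 0.
  case: (eqVneq Y i) => [->|Yi].
    rewrite entry_beta1_at // ?mem_shifted // eta_len1 // /hom_comp delta_xyy expr0.
    by rewrite -/h mulr1 -scalerAr mulrA.
  by rewrite entry_beta1_into ?mem_shifted //= xpair_eqE andbF.
rewrite B1 {B1}; case: (eqVneq X i) => [Xi|Xi].
  subst X; rewrite (entry_beta2_at i_gt0 i_ltN) /= !sgn_eq !scale0r add0r addr0.
  rewrite if_same subr0 eta_nil_at //; last by rewrite !inE; case: ifP; rewrite eqxx ?orbT.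
  rewrite -/h /hom_comp; case: (ltngtP Y i) => [Yi|Yi|/val_inj ->].
  - rewrite [delta i Q i]delta_beyond ?QE; last lia.
    rewrite [delta i Y i]delta_beyond; last lia.
    rewrite dist_nxt // sgn_lt // !scale1r.
    have -> : ob_dist i Y = (ob_dist i Y).-1.+1 by rewrite /ob_dist; lia.
    by move: (ob_dist i Y).-1 => n /=; rewrite !exprS expr0; ring.
  - rewrite [delta i P i]delta_beyond ?PE; last lia.
    rewrite [delta i Y i]delta_beyond; last lia.
    rewrite dist_prv // sgn_gt // !scaleN1r.
    have -> : ob_dist i Y = (ob_dist i Y).-1.+1 by rewrite /ob_dist; lia.
    by move: (ob_dist i Y).-1 => n /=; rewrite !exprS expr0; ring.
  - by rewrite sgn_eq !scale0r !mul0r subrr.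
rewrite (entry_beta2_away i_gt0 i_ltN) // eta_nil_away // add0r -{1}E2.
rewrite /hom_comp delta_xxy expr0 mulr1 /=.
case: (ltngtP Y i) => [Yi|Yi|/val_inj Ye]; last first.
- rewrite Ye eqxx sgn_eq subrr mulr0 ltxx !scale0r !mul0r delta_xyy expr0 mulr1.
  by rewrite !sub0r oppr0 addr0 addNr.
- have -> : (Y == i) = false by apply/negbTE; rewrite -val_eqE /=; lia.
  case: (ltngtP X i) => [Xlt|Xgt|/val_inj Xe]; last by rewrite Xe eqxx in Xi.
    have X_pos : 0 < (i : int) - (X : int) by lia.
    have Y_neg : (i : int) - (Y : int) < 0 by lia.
    rewrite (pmulr_rlt0 _ X_pos) Y_neg.
    rewrite delta_beyond; last lia.
    rewrite (sgn_lt Xlt) (sgn_gt Yi) !scaleN1r scale1r.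
    have -> : ob_dist i Y = (ob_dist i Y).-1.+1 by rewrite /ob_dist; lia.
    by move: (ob_dist i Y).-1 => n /=; rewrite !exprS; ring.
  rewrite ltNge mulr_le0 /=; try lia.
  by rewrite (sgn_gt Xgt) (sgn_gt Yi) !scaleN1r; ring.
- have -> : (Y == i) = false by apply/negbTE; rewrite -val_eqE /=; lia.
  case: (ltngtP X i) => [Xlt|Xgt|/val_inj Xe]; last by rewrite Xe eqxx in Xi.
    rewrite ltNge mulr_ge0 /=; try lia.
    by rewrite (sgn_lt Xlt) (sgn_lt Yi) !scale1r; ring.
  have X_neg : (i : int) - (X : int) < 0 by lia.
  have Y_pos : 0 < (i : int) - (Y : int) by lia.
  rewrite (nmulr_rlt0 _ X_neg) Y_pos.
  rewrite delta_beyond; last lia.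
  rewrite (sgn_gt Xgt) (sgn_lt Yi) !scaleN1r !scale1r.
  have -> : ob_dist i Y = (ob_dist i Y).-1.+1 by rewrite /ob_dist; lia.
  by move: (ob_dist i Y).-1 => n /=; rewrite !exprS; ring.
Qed.

Lemma eta_nat_trans (e : hom) : nat_trans 0 (eta i e).
Proof.
split; first exact: eta_prenat.
apply: prefamilyP => X Y p; rewrite [RHS](_ : _ = 0) //.
have := @homog_nat_diff _ _ _ _ _ _ _ p (eta_prenat i e).
case: p => [U|U V W a p]; first by apply: homog_eq0.
case: p a => [U'|U' V' W' b p] a; first by rewrite eta_len1_cocycle.
case: p b => [U''|U'' V'' W'' c p] b; first by rewrite eta_len2_cocycle.
by apply: homog_eq0 => //=; lia.
Qed.

(** The general transformation of degree -1: its only component is a morphism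
    from T_i to the shifted summand T_i of beta(T_i). *)
Definition cone_shift (w : hom) : prefamily k i := Family (fun X Y p =>
  match p in chain _ X Y return twmat k (tw_inj k X) (beta k i Y) with
  | cnil X => mat_of _ _ (fun _ t => if (X == i) && (t == (i, -1)) then w else 0)
  | ccons _ _ _ _ _ => 0
  end).

Lemma cone_shift_prenat w : prenat (- 1) (cone_shift w).
Proof.
split=> [X Z W Y p q c a b|X Y [U|U V T a p]] /=.
- by case: p => [U|U V T d p] /=; rewrite scaler0 addr0.
- apply: homog_mat_of => s t; rewrite !inE => /eqP -> _ /=.
  by case: ifP => [/andP[_ /eqP ->]|]; rewrite ?eqxx.
- exact: homog0.
Qed.

(** The decomposition is forced: u + v is unchanged by a coboundary, so it must be
    e, and w is half of the difference v - u. *)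
Lemma cocycle_decomp (f : prefamily k i) : nat_trans 0 f ->
  exists e w, f = eta i e + nat_diff (-1) (cone_shift w).
Proof.
case=> -[_ fdeg] fcyc.
have cyc X Y p : nat_diff 0 f X Y p = 0 by rewrite fcyc.
pose u := entry (f i i (cnil k i)) (P, 0) (i, 0).
pose v := entry (f i i (cnil k i)) (Q, 0) (i, 0).
exists (u + v), (2^-1 *: (v - u)).
set e := u + v; set w := _ *: _.
have uE : u = 2^-1 *: e - w by rewrite /e /w -scalerBr -[LHS]half_double -scalerDr; congr (_ *: _); ring.
have vE : v = 2^-1 *: e + w by rewrite /e /w -scalerDr -[LHS]half_double -scalerDr; congr (_ *: _); ring.
(* The morphism a_{Xi} : T_i -> T_X, that is the polynomial 1, is enough here. *)
have f0 X : X != i -> entry (f X X (cnil k X)) (X, 0) (X, 0) = e * 'X.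
  move=> Xi; have := nat_diff_from i_gt0 i_ltN f 1 Xi; rewrite cyc entry0 mul1r mulr1.
  by move/esym/eqP; rewrite subr_eq0 mulrC => /eqP <-.
(* Of the two equations for c_X, the one at the neighbour of T_i on the far side
   from T_X carries no factor 'X. *)
have f1_lt (X : 'I_N.+1) a : (X < i)%N ->
    entry (f X i (ccons X a (cnil k i))) (i, -1) (X, 0) = v * a.
  move=> Xi; have := nat_diff_below_nxt i_gt0 i_ltN f a Xi; rewrite cyc entry0.
  by move/esym/eqP; rewrite subr_eq0 => /eqP.
have f1_gt (X : 'I_N.+1) a : (i < X)%N ->
    entry (f X i (ccons X a (cnil k i))) (i, -1) (X, 0) = - (u * a).
  move=> Xi; have := nat_diff_above_prv i_gt0 i_ltN f a Xi; rewrite cyc entry0.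
  by move/esym/eqP; rewrite subr_eq0 => /eqP <-; rewrite opprK.
have f1_eq a : entry (f i i (ccons i a (cnil k i))) (i, -1) (i, 0) = 0.
  by rewrite -nat_diff_at_nxt // cyc entry0.
apply: prefamilyP => X Y p.
rewrite [RHS](_ : _ = eta i e X Y p + nat_diff (-1) (cone_shift w) X Y p) //.
have dw := @homog_nat_diff _ _ _ _ _ _ _ p (cone_shift_prenat w).
have de := @eta_homog _ _ i e _ _ p.
have df := fdeg _ _ p.
have w0 : entry (cone_shift w i i (cnil k i)) (i, -1) (i, 0) = w.
  by rewrite entry_mat_of ?uniq_beta_terms // mem_shifted !inE !eqxx.
have w0' t : t != (i, -1) -> entry (cone_shift w i i (cnil k i)) t (i, 0) = 0.
  move=> ti; rewrite entry_mat_of ?uniq_beta_terms // (negPf ti) andbF.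
  by rewrite if_same.
have w0'' Z t : Z != i -> entry (cone_shift w Z Z (cnil k Z)) t (Z, 0) = 0.
  by move=> Zi; rewrite entry_mat_of ?uniq_beta_terms // (negPf Zi) /= if_same.
case: p dw de df => [Z|U V W a p] dw de df.
  apply: twmat_ext => // t tZ; rewrite entryD.
  case: (eqVneq Z i) tZ dw de df => [->|Zi] tZ dw de df; last first.
    move: tZ; rewrite mem_beta_terms (negPf Zi) => /eqP ->.
    rewrite f0 // eta_nil_away // nat_diffN_nil entryN entry_diff ?mem_beta_away //.
    by rewrite (negPf Zi) oppr0 addr0.
  rewrite nat_diffN_nil entryN entry_diff // eqxx andTb.
  move: tZ; rewrite mem_beta_terms eqxx => /or3P[] /eqP ->.
  - by rewrite (homog_entry df) // (homog_entry de) // /= oppr0 addr0.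
  - rewrite eta_nil_at ?inE ?eqxx // w0 /= ?eqxx /hom_comp delta_xxy expr0.
    by rewrite -/u uE; ring.
  - rewrite eta_nil_at ?inE ?eqxx ?orbT // w0 /= (eq_sym Q) (negPf (prv_neq_nxt _ _)) //.
    by rewrite /hom_comp delta_xxy expr0 -/v vE; ring.
case: p a dw de df => [Y'|U' V' W' b p] a dw de df; last first.
  rewrite (homog_eq0 _ _ df); try by rewrite /=; lia.
  rewrite (homog_eq0 _ _ de); try by rewrite /=; lia.
  by rewrite (homog_eq0 _ _ dw) ?addr0 //=; lia.
apply: twmat_ext => // t tY; rewrite entryD.
have [t1|t1] := boolP (t.2 == -1); last first.
  by rewrite (homog_entry df) // (homog_entry de) // (homog_entry dw) // addr0.
case: (eqVneq Y' i) tY dw de df => [->|Yi]; last first.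
  by rewrite mem_beta_terms (negPf Yi) => /eqP tE; rewrite tE in t1.
rewrite mem_beta_terms eqxx => /or3P[] /eqP tE dw de df; rewrite tE // in t1 *.
rewrite eta_len1 // nat_diffN_len1 !(entryD, entryN) entry_precomp // w0.
rewrite [X in X - _ + _](_ : _ = 0); last by rewrite /= tcompr0 entry0.
rewrite /= /hom_comp delta_xyy expr0 sub0r.
case: (ltngtP U i) => [Ui|Ui|/val_inj ->].
- have Un : U != i by rewrite -val_eqE /=; lia.
  rewrite f1_lt // sgn_lt // scale1r entry_beta1_into ?mem_shifted //=.
  by rewrite xpair_eqE andbF vE; ring.
- have Un : U != i by rewrite -val_eqE /=; lia.
  rewrite f1_gt // sgn_gt // scaleN1r entry_beta1_into ?mem_shifted //=.
  by rewrite xpair_eqE andbF uE; ring.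
- rewrite f1_eq sgn_eq scale0r entry_beta1_at ?mem_shifted // w0 /hom_comp delta_xxy expr0.
  by ring.
Qed.

(** A transformation of degree -1 is zero on T_X for X <> i, and the
    differential of beta(T_X) is zero as well. *)
Lemma exact_vanish_away (f : prefamily k i) X : X != i -> exact_nat 0 f ->
  entry (f X X (cnil k X)) (X, 0) (X, 0) = 0.
Proof.
move=> Xi [h]; rewrite sub0r => -[_ hdeg] ->.
rewrite nat_diffN_nil entryN entry_diff ?mem_beta_away //.
by rewrite (negPf Xi) oppr0.
Qed.

(** The sum defining eta is cut off at the size of e, which is not additive; the
    closed forms of the entries are. *)
Lemma eta_linear : linear (@eta k N i).
Proof.
move=> c e e'; apply: prefamilyP => X Y p.
rewrite [RHS](_ : _ = c *: eta i e X Y p + eta i e' X Y p) //.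
have deg e1 := @eta_homog _ _ i e1 _ _ p.
case: p deg => [Z|U V W a p] deg.
  apply: twmat_ext => // t tZ; rewrite entryD entryZ.
  case: (eqVneq Z i) tZ deg => [->|Zi]; rewrite mem_beta_terms ?eqxx ?(negPf Zi).
    case/or3P => /eqP -> deg.
    - by rewrite !(homog_entry (deg _)) // scaler0 addr0.
    - by rewrite !eta_nil_at ?inE ?eqxx // scalerDr !scalerA mulrC.
    - by rewrite !eta_nil_at ?inE ?eqxx ?orbT // scalerDr !scalerA mulrC.
  by move=> /eqP -> _; rewrite !eta_nil_away // mulrDl scalerAl.
case: p a deg => [Y'|U' V' W' b p] a deg; last first.
  rewrite !(homog_eq0 _ _ (deg _)) ?scaler0 ?addr0 //=; lia.
apply: twmat_ext => // t tY; rewrite entryD entryZ.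
have [t1|t1] := boolP (t.2 == -1); last first.
  by rewrite !(homog_entry (deg _)) // scaler0 addr0.
case: (eqVneq Y' i) tY deg => [->|Yi] tY _; last first.
  by move: tY; rewrite mem_beta_terms (negPf Yi) => /eqP tE; rewrite tE in t1.
move: tY; rewrite mem_beta_terms eqxx => /or3P[] /eqP tE; rewrite tE // in t1 *.
rewrite !eta_len1 // !scalerDr mulrDr scalerDr; congr (_ + _).
by rewrite -!scalerAr !scalerA; congr (_ *: _); ring.
Qed.

Lemma eta_HH_class : exists etaP : forall e : {poly k}, nat_trans 0 (eta i e),
    linear (fun e : {poly k} => HH_class (etaP e) : HH i 0) /\
    bijective (fun e : {poly k} => HH_class (etaP e)).
Proof.
exists eta_nat_trans.
have lin : linear (fun e : {poly k} => HH_class (eta_nat_trans e) : HH i 0).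
  move=> c e e'; rewrite /HH_class -lmod_pi_linear; congr (lmod_pi _ _).
  by apply: val_inj; rewrite /= eta_linear.
(* T_{i-1} serves as the object other than T_i on which eta is s e. *)
split=> //; have Pi : P != i by apply: prv_neq.
have inj : injective (fun e : {poly k} => HH_class (eta_nat_trans e)).
  move=> e e' /lmod_piE /asboolP /(exact_vanish_away Pi).
  rewrite [cocycle_fam _](_ : _ = eta i e - eta i e') //.
  rewrite [fam _ _](_ : _ = eta i e P P (cnil k P) - eta i e' P P (cnil k P)) //.
  rewrite entryD entryN !eta_nil_away // -mulrBl => /eqP.
  by rewrite mulf_eq0 polyX_eq0 orbF subr_eq0 => /eqP.
have surj x : exists e, HH_class (eta_nat_trans e) = x.
  have [f ->] := lmod_pi_surj x; have /asboolP fP := cocycleP f.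
  have [e [w fE]] := cocycle_decomp fP.
  exists e; apply/esym/lmod_piE/asboolP; exists (cone_shift w); first exact: cone_shift_prenat.
  by rewrite sub0r /= fE addrAC subrr add0r.
have [g gK] := choice surj.
by exists g => // e; apply: inj; rewrite gK.
Qed.
End Cohomology.

Theorem theorem9p7 (k : fieldType) (N : nat) (i : 'I_N.+1)
    (char_neq2 : 2%N \notin [pchar k]) (N_ge2 : (2 <= N)%N)
    (i_range : (1 <= i <= N - 1)%N) :
  exists etaP : forall e : {poly k}, nat_trans (i := i) 0 (eta i e),
    linear (fun e : {poly k} => HH_class (etaP e) : HH i 0) /\
    bijective (fun e : {poly k} => HH_class (etaP e)).
Proof.
have [i_gt0 i_ltN] : (0 < i)%N /\ (i < N)%N by split; lia.
by apply: eta_HH_class => //; rewrite inE in char_neq2.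
Qed.
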